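(* Let $m,n\ge2$ and $K\ge1$. Fix orthogonal matrices $U\in\mathbb R^{m\times m}$, $V\in\mathbb R^{n\times n}$, and let $H=(V\otimes U)\operatorname{diag}(h_{ij})(V\otimes U)^\top$ with all $h_{ij}>0$. Put $\ell_{ij}=\log h_{ij}$ and $L=(\ell_{ij})\in\mathbb R^{m\times n}$. The optimal fixed-basis log-threshold $$\tau^\star_{U,V}(H)=\min_{a\in\mathbb R^m,\,b\in\mathbb R^n}\Bigl[\max_{i,j}(\ell_{ij}-a_i-b_j)-\min_{i,j}(\ell_{ij}-a_i-b_j)\Bigr]$$ has the exact dual representation $$\tau^\star_{U,V}(H)=\max_W\langle W,L\rangle,$$ where the maximum is over $W\in\mathbb R^{m\times n}$ satisfying $$\sum_jW_{ij}=0\ \ \forall i,\qquad \sum_iW_{ij}=0\ \ \forall j,\qquad \sum_{i,j}|W_{ij}|\le2.$$ Equivalently, any nonzero optimal $W$ can be normalized (rescaled by a positive factor, remaining optimal) so that $\sum_{ij}W_{ij}^+=\sum_{ij}W_{ij}^-=1$. Hence any feasible $W$ with $\langle W,L\rangle>\log K$ certifies that the fixed-basis Kronecker target is infeasible, i.e. that no $G\in\mathcal K_{U,V}$ satisfies $\kappa(G^{-1}H)\le K$.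
   Context: The fixed-basis Kronecker family is $\mathcal K_{U,V}=\{(V\operatorname{diag}(e^{b_1},\ldots,e^{b_n})V^\top)\otimes(U\operatorname{diag}(e^{a_1},\ldots,e^{a_m})U^\top):a\in\mathbb R^m,\ b\in\mathbb R^n\}$. In the expression for $H$, $h_{ij}$ ($1\le i\le m$, $1\le j\le n$) is the eigenvalue of $H$ on $v_j\otimes u_i$, where $u_i,v_j$ are the columns of $U,V$. $\langle W,L\rangle=\sum_{ij}W_{ij}L_{ij}$, $W_{ij}^\pm=\max\{\pm W_{ij},0\}$. $\kappa(G^{-1}H)$ is the ratio of the largest to the smallest generalized eigenvalue in $Hv=\lambda Gv$. *)

(* Defs.v *)
From HB Require Import structures.
From mathcomp Require Import all_boot all_order all_algebra.
From mathcomp Require Import mxtens.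
From mathcomp Require Import all_classical all_reals all_analysis.

Set Implicit Arguments.
Unset Strict Implicit.
Unset Printing Implicit Defensive.

Import Order.TTheory GRing.Theory Num.Theory.
Local Open Scope classical_set_scope.
Local Open Scope ring_scope.

Definition orthogonal_mx (R : realType) (k : nat) (Q : 'M[R]_k) : Prop :=
  Q^T *m Q = 1%:M.

Definition is_maximum (R : realType) (A : set R) (x : R) : Prop :=
  A x /\ ubound A x.

Definition is_minimum (R : realType) (A : set R) (x : R) : Prop :=
  A x /\ lbound A x.

Definition entries (R : realType) (m n : nat) (M : 'M[R]_(m, n)) : set R :=
  [set M ij.1 ij.2 | ij in [set: 'I_m * 'I_n]].

(* For m, n > 0 the entries form a finite nonempty set, so the supremum and
   the infimum are the maximal and the minimal entry. *)
Definition spread (R : realType) (m n : nat) (M : 'M[R]_(m, n)) : R :=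
  sup (entries M) - inf (entries M).

(* Following [mxtens], the basis vector of R^n (x) R^m with index
   [mxtens_index (j, i)] is e_j (x) e_i; it carries the weight h_ij. *)
Definition kron_diag (R : realType) (m n : nat) (h : 'M[R]_(m, n)) :
    'M[R]_(n * m) :=
  diag_mx (\row_k h (mxtens_unindex k).2 (mxtens_unindex k).1).

Definition kron_spectral (R : realType) (m n : nat)
    (U : 'M[R]_m) (V : 'M[R]_n) (h : 'M[R]_(m, n)) : 'M[R]_(n * m) :=
  (tensmx V U) *m kron_diag h *m (tensmx V U)^T.

Definition kron_family (R : realType) (m n : nat)
    (U : 'M[R]_m) (V : 'M[R]_n) : set 'M[R]_(n * m) :=
  [set G | exists (a : 'rV[R]_m) (b : 'rV[R]_n),
     G = tensmx (V *m diag_mx (map_mx expR b) *m V^T)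
                (U *m diag_mx (map_mx expR a) *m U^T)].

Definition gen_eigenvalues (R : realType) (N : nat) (G H : 'M[R]_N) : set R :=
  [set lam | exists2 v : 'cV[R]_N, v != 0 & H *m v = lam *: (G *m v)].

(* kappa (G^-1 H).  For G invertible and N > 0, as soon as the pencil has a
   real eigenvalue, the set is finite and nonempty, so that sup and inf are the
   largest and the smallest generalized eigenvalue. *)
Definition gen_cond (R : realType) (N : nat) (G H : 'M[R]_N) : R :=
  sup (gen_eigenvalues G H) / inf (gen_eigenvalues G H).

Definition log_mx (R : realType) (m n : nat) (h : 'M[R]_(m, n)) :
    'M[R]_(m, n) := map_mx (@ln R) h.

Definition primal_values (R : realType) (m n : nat) (L : 'M[R]_(m, n)) :
    set R :=
  [set t | exists (a : 'rV[R]_m) (b : 'rV[R]_n),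
     t = spread (\matrix_(i, j) (L i j - a 0 i - b 0 j))].

Definition tau_star (R : realType) (m n : nat) (L : 'M[R]_(m, n)) : R :=
  inf (primal_values L).

Definition pairing (R : realType) (m n : nat) (W L : 'M[R]_(m, n)) : R :=
  \sum_i \sum_j W i j * L i j.

Definition dual_feasible (R : realType) (m n : nat) (W : 'M[R]_(m, n)) : Prop :=
  [/\ forall i, \sum_j W i j = 0,
      forall j, \sum_i W i j = 0
    & \sum_i \sum_j `|W i j| <= 2].

Definition dual_values (R : realType) (m n : nat) (L : 'M[R]_(m, n)) : set R :=
  [set pairing W L | W in [set W | dual_feasible W]].

Definition dual_optimal (R : realType) (m n : nat) (L W : 'M[R]_(m, n)) :
    Prop :=
  dual_feasible W /\ ubound (dual_values L) (pairing W L).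

Definition pos_part_mx (R : realType) (m n : nat) (W : 'M[R]_(m, n)) :
    'M[R]_(m, n) := \matrix_(i, j) Num.max (W i j) 0.

Definition neg_part_mx (R : realType) (m n : nat) (W : 'M[R]_(m, n)) :
    'M[R]_(m, n) := \matrix_(i, j) Num.max (- W i j) 0.

(* Main.v *)
Require Import Defs.
From mathcomp Require Import all_boot all_order all_algebra.
From mathcomp Require Import mxtens lra ring.
From mathcomp Require Import all_classical all_reals all_analysis.

(** Duality.  Write [t] for the largest value of the pairing of [L] with a
feasible weight; it is attained because the feasible weights form a compact set
([dual_optimal_exists]).

A feasible [W] has zero row and column sums, so it pairs equally with [L] and
with every residual [L i j - a i - b j].  As its total sum vanishes too, that
residual may be recentred at the middle of its range, and then its entries are
at most half of its spread in absolute value, while the entries of [W] have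
total absolute value at most 2.  Hence no spread is below the pairing
([weak_duality]).

For the converse, potentials [a], [b] whose residual stays in [[0, t]] have to
be found.  The numbers [b j] can be eliminated: they exist as soon as [a]
satisfies the difference constraints [a i + (L i' j - L i j - t) <= a i'].
This system is solved as in shortest-path theory.  Steps [i -> i'] through a
column [j], of gain [L i' j - L i j - t], form walks in the complete bipartite
graph of rows and columns ([altwalk]).  A closed walk with [k] steps carries a
signed count of traversed edges which, divided by [k], is a feasible weight; so
by definition of [t] closed walks have nonpositive gain ([closed_altwalk_le]).
The supremum of the gains of the walks from a fixed row to [i] is then the
required [a i] ([potential_exists]); it is finite because one more step closes
every such walk.

Certificate.  The matrices of the Kronecker family are diagonal in the same
orthonormal basis as [H], so the generalized eigenvalues are the quotients
[h i j / (expR (a i) * expR (b j))] ([gen_eigenvalues_kron]).  Their logarithms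
are the entries of a residual of [L], whose spread is thus at most the logarithm
of the condition number ([expR_spread_ln_le]).  A weight whose pairing exceeds
[ln K] contradicts weak duality. *)

Import Order.TTheory GRing.Theory Num.Theory.
Import numFieldNormedType.Exports.
Local Open Scope classical_set_scope.
Local Open Scope ring_scope.

Set Implicit Arguments.
Unset Strict Implicit.
Unset Printing Implicit Defensive.

(** * The pairing and weak duality *)

Section Duality.
Variables (R : realType) (m n : nat).
Implicit Types (L M W : 'M[R]_(m, n)) (a : 'rV[R]_m) (b : 'rV[R]_n).

Lemma pairingDl W1 W2 L : pairing (W1 + W2) L = pairing W1 L + pairing W2 L.
Proof.
rewrite /pairing -big_split; apply: eq_bigr => i _ /=.
by rewrite -big_split; apply: eq_bigr => j _; rewrite mxE mulrDl.
Qed.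

Lemma pairingZl c W L : pairing (c *: W) L = c * pairing W L.
Proof.
rewrite /pairing mulr_sumr; apply: eq_bigr => i _.
by rewrite mulr_sumr; apply: eq_bigr => j _; rewrite mxE mulrA.
Qed.

Lemma pairingBl W1 W2 L : pairing (W1 - W2) L = pairing W1 L - pairing W2 L.
Proof. by rewrite pairingDl -scaleN1r pairingZl mulN1r. Qed.

Lemma pairing0l L : pairing 0 L = 0.
Proof.
by rewrite /pairing big1 // => i _; rewrite big1 // => j _; rewrite mxE mul0r.
Qed.

Lemma pairing_delta i j L : pairing (delta_mx i j) L = L i j.
Proof.
rewrite /pairing (bigD1 i) //= (bigD1 j) //= mxE !eqxx mul1r.
rewrite !big1 ?addr0 // => [k /negPf ki | k /negPf kj].
  by apply: big1 => l _; rewrite mxE ki mul0r.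
by rewrite mxE kj andbF mul0r.
Qed.

Definition residual L a b : 'M[R]_(m, n) :=
  \matrix_(i, j) (L i j - a 0 i - b 0 j).

Lemma pairing_residual W L a b : dual_feasible W ->
  pairing W (residual L a b) = pairing W L.
Proof.
case=> rowW colW _.
have -> : pairing W (residual L a b) = pairing W L
    - \sum_i \sum_j W i j * a 0 i - \sum_i \sum_j W i j * b 0 j.
  rewrite /pairing -!sumrB; apply: eq_bigr => i _ /=.
  by rewrite -!sumrB; apply: eq_bigr => j _ /=; rewrite mxE !mulrBr.
rewrite [X in _ - X - _]big1 => [|i _]; last by rewrite -mulr_suml rowW mul0r.
rewrite exchange_big [X in _ - _ - X]big1 ?subr0 // => j _.
by rewrite -mulr_suml colW mul0r.
Qed.

Lemma sum_dual_feasible W : dual_feasible W -> \sum_i \sum_j W i j = 0.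
Proof. by case=> rowW _ _; apply: big1. Qed.

(** The total sum of [W] is 0, so [M] may be recentred at the midpoint of
[lo, hi]; half of the width times the total absolute value 2 is the bound. *)
Lemma pairing_le_width W M lo hi : dual_feasible W -> lo <= hi ->
  (forall i j, lo <= M i j <= hi) -> pairing W M <= hi - lo.
Proof.
move=> Wf lohi Mb; set c := (lo + hi) / 2.
have -> : pairing W M = \sum_i \sum_j W i j * (M i j - c).
  transitivity (pairing W M - (\sum_i \sum_j W i j) * c).
    by rewrite (sum_dual_feasible Wf) mul0r subr0.
  rewrite mulr_suml -sumrB; apply: eq_bigr => i _; rewrite mulr_suml -sumrB.
  by apply: eq_bigr => j _; rewrite mulrBr.
apply: (@le_trans _ _ ((hi - lo) / 2 * \sum_i \sum_j `|W i j|)); last first.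
  case: Wf => _ _ Wn; rewrite -[leRHS](@divfK _ 2) //.
  by apply: ler_wpM2l => //; lra.
rewrite mulr_sumr; apply: ler_sum => i _; rewrite mulr_sumr.
apply: ler_sum => j _; apply: le_trans (ler_norm _) _.
rewrite normrM mulrC ler_wpM2r // ler_norml.
by move: (Mb i j); rewrite /c => /andP[]; lra.
Qed.

Lemma has_ubound_finite (T : finType) (f : T -> R) (D : set T) :
  has_ubound (f @` D).
Proof.
exists (\sum_x `|f x|) => _ [x _ <-]; apply: le_trans (ler_norm _) _.
by rewrite (bigD1 x) //= lerDl sumr_ge0.
Qed.

Lemma has_lbound_finite (T : finType) (f : T -> R) (D : set T) :
  has_lbound (f @` D).
Proof.
apply/has_lb_ubN; rewrite image_comp; exact: has_ubound_finite.
Qed.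

Lemma entriesP M i j : entries M (M i j).
Proof. by exists (i, j). Qed.

Lemma inf_entries_le M i j : inf (entries M) <= M i j.
Proof. exact: (ge_inf (has_lbound_finite _ _) (entriesP _ _ _)). Qed.

Lemma le_sup_entries M i j : M i j <= sup (entries M).
Proof. exact: (ub_le_sup (has_ubound_finite _ _) (entriesP _ _ _)). Qed.

Lemma spread_ge0 M : 0 <= spread M.
Proof.
rewrite /spread subr_ge0.
have [/eqP-> | /set0P[_ [[i j] _ _]]] := boolP (entries M == set0).
  (* [sup] and [inf] of the empty set are both 0 by convention. *)
  by rewrite sup0 inf0.
exact: le_trans (inf_entries_le M i j) (le_sup_entries M i j).
Qed.

Lemma weak_duality W L a b : dual_feasible W ->
  pairing W L <= spread (residual L a b).
Proof.
move=> Wf; rewrite -(pairing_residual L a b Wf); apply: pairing_le_width => //.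
  by rewrite -subr_ge0; exact: spread_ge0.
by move=> i j; rewrite inf_entries_le le_sup_entries.
Qed.

(** * Existence of an optimal weight *)

Lemma dual_feasibleZ c W : 0 <= c -> c * \sum_i \sum_j `|W i j| <= 2 ->
  (forall i, \sum_j W i j = 0) -> (forall j, \sum_i W i j = 0) ->
  dual_feasible (c *: W).
Proof.
move=> c0 Wn rowW colW; split.
- by move=> i; under eq_bigr do rewrite mxE; rewrite -mulr_sumr rowW mulr0.
- by move=> j; under eq_bigr do rewrite mxE; rewrite -mulr_sumr colW mulr0.
apply: le_trans Wn; rewrite mulr_sumr ler_sum // => i _.
by rewrite mulr_sumr ler_sum // => j _; rewrite mxE normrM ger0_norm.
Qed.

Lemma dual_feasible0 : dual_feasible (0 : 'M[R]_(m, n)).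
Proof.
rewrite -(scale0r (0 : 'M[R]_(m, n))); apply: dual_feasibleZ => //.
- by rewrite mul0r.
- by move=> i; rewrite big1 // => j _; rewrite mxE.
- by move=> j; rewrite big1 // => i _; rewrite mxE.
Qed.

Lemma continuous_vec_mx i j :
  continuous (fun v : 'rV[R]_(m * n) => vec_mx v i j).
Proof.
have -> : (fun v : 'rV[R]_(m * n) => vec_mx v i j) =
    (fun v => v 0 (mxvec_index i j)) by apply/funext => v; rewrite mxE.
exact: coord_continuous.
Qed.

Lemma continuous_sum (T : topologicalType) (I : finType) (f : I -> T -> R) :
  (forall i, continuous (f i)) -> continuous (fun x => \sum_i f i x).
Proof.
move=> fc; apply: continuous_big; first exact: add_continuous.
by move=> i _; exact: fc.
Qed.

(** The feasible weights form a closed subset of a compact cube, since the bound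
on the total absolute value puts every entry in [[-2, 2]]; and the pairing is
continuous.  The topology is that of the row vectors listing the entries. *)
Lemma dual_optimal_exists L : exists W, dual_optimal L W.
Proof.
pose A : set 'rV[R]_(m * n) := [set v | dual_feasible (vec_mx v)].
have closedA : closed A.
  pose r i (v : 'rV[R]_(m * n)) := \sum_j vec_mx v i j.
  pose c j (v : 'rV[R]_(m * n)) := \sum_i vec_mx v i j.
  pose l (v : 'rV[R]_(m * n)) := \sum_i \sum_j `|vec_mx v i j|.
  have -> : A = (\bigcap_i r i @^-1` [set x | x = 0]) `&`
      ((\bigcap_j c j @^-1` [set x | x = 0]) `&` l @^-1` [set x | x <= 2]).
    apply/seteqP; split=> v.
      case=> rv cv lv; split=> [i _|]; first exact: rv.
      by split=> [j _|]; [exact: cv | exact: lv].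
    by case=> rv [cv lv]; split=> [i|j|]; [exact: rv | exact: cv | exact: lv].
  apply: closedI; first apply: closed_bigI => i _.
    apply: preimage_closed (@closed_eq _ _) => v _.
    by apply: continuous_sum => j; exact: continuous_vec_mx.
  apply: closedI; first apply: closed_bigI => j _.
    apply: preimage_closed (@closed_eq _ _) => v _.
    by apply: continuous_sum => i; exact: continuous_vec_mx.
  apply: preimage_closed (@closed_le _ _) => v _.
  apply: continuous_sum => i; apply: continuous_sum => j w.
  exact: continuous_comp (@continuous_vec_mx i j w) (@norm_continuous _ _ _).
have compactA : compact A.
  have boxc := @rV_compact R (m * n) (fun=> `[-2, 2]%classic)
                           (fun=> @segment_compact R (-2) 2).
  apply: (subclosed_compact closedA boxc).
  move=> v [_ _ lv] k /=; rewrite in_itv /= -ler_norml; apply: le_trans lv.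
  case/mxvec_indexP: k => i j; rewrite (bigD1 i) //= (bigD1 j) //= mxE -addrA.
  by rewrite lerDl addr_ge0 // sumr_ge0 // => k _; exact: sumr_ge0.
have contP : continuous (fun v : 'rV[R]_(m * n) => pairing (vec_mx v) L).
  apply: continuous_sum => i; apply: continuous_sum => j v.
  exact: (cvgM (@continuous_vec_mx i j v) (cvg_cst (L i j))).
have [||v Av vmax] :=
    @EVT_max_rV R _ (fun v => pairing (vec_mx v) L) A _ compactA.
- by exists (mxvec 0); rewrite /A /= mxvecK; exact: dual_feasible0.
- exact: continuous_subspaceT.
exists (vec_mx v); split; first by move: Av; rewrite inE.
move=> _ [W Wf <-]; rewrite -(mxvecK W); apply: vmax.
by rewrite inE /A /= mxvecK.
Qed.

(** * Strong duality by alternating walks *)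

(** Walks from row to row in the complete bipartite graph of rows and columns:
[k] is the number of steps [i -> j -> i'], and [W] the signed count of the edges
used.  The vertices visited are not recorded, because the gain of a walk is
[pairing W L - k * t]. *)
Inductive altwalk (i0 : 'I_m) : 'I_m -> nat -> 'M[R]_(m, n) -> Prop :=
| altwalk0 : altwalk i0 i0 0 0
| altwalkS i k W j i' : altwalk i0 i k W ->
    altwalk i0 i' k.+1 (W + delta_mx i' j - delta_mx i j).

Lemma sum_row_delta (i i' : 'I_m) (j' : 'I_n) :
  \sum_j (delta_mx i' j' : 'M[R]_(m, n)) i j = (i == i')%:R.
Proof.
rewrite (bigD1 j') //= mxE eqxx andbT big1 ?addr0 // => k /negPf kj.
by rewrite mxE kj andbF.
Qed.

Lemma sum_col_delta (j : 'I_n) (i' : 'I_m) (j' : 'I_n) :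
  \sum_i (delta_mx i' j' : 'M[R]_(m, n)) i j = (j == j')%:R.
Proof.
rewrite (bigD1 i') //= mxE eqxx big1 ?addr0 // => k /negPf ki.
by rewrite mxE ki.
Qed.

Lemma addBmxE (W W' W'' : 'M[R]_(m, n)) i j :
  (W + W' - W'') i j = W i j + W' i j - W'' i j.
Proof. by rewrite [LHS]mxE [X in X + _]mxE [X in _ + X]mxE. Qed.

(** Every visit to a row enters and leaves it, with opposite signs; only the
two ends of the walk are left over. *)
Lemma altwalk_row i0 i k W r : altwalk i0 i k W ->
  \sum_j W r j = (r == i)%:R - (r == i0)%:R.
Proof.
elim=> [|{}i {}k {}W j i' _ IH].
  by rewrite subrr big1 // => j _; rewrite mxE.
under eq_bigr do rewrite addBmxE.
by rewrite sumrB big_split /= IH !sum_row_delta; ring.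
Qed.

(** Each step uses two edges of the same column, with opposite signs. *)
Lemma altwalk_col i0 i k W c : altwalk i0 i k W -> \sum_i W i c = 0.
Proof.
elim=> [|{}i {}k {}W j i' _ IH]; first by rewrite big1 // => r _; rewrite mxE.
under eq_bigr do rewrite addBmxE.
by rewrite sumrB big_split /= IH !sum_col_delta; ring.
Qed.

Lemma sum_norm_delta (i' : 'I_m) (j' : 'I_n) :
  \sum_i \sum_j `|(delta_mx i' j' : 'M[R]_(m, n)) i j| = 1.
Proof.
rewrite (bigD1 i') //= (bigD1 j') //= mxE !eqxx normr1.
rewrite !big1 ?addr0 // => [k /negPf ki | k /negPf kj].
  by apply: big1 => l _; rewrite mxE ki normr0.
by rewrite mxE kj andbF normr0.
Qed.

Lemma altwalk_norm i0 i k W : altwalk i0 i k W ->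
  \sum_i \sum_j `|W i j| <= 2 * k%:R.
Proof.
elim=> [|{}i {}k {}W j i' _ IH].
  by rewrite mulr0 big1 // => r _; rewrite big1 // => c _; rewrite mxE normr0.
apply: (@le_trans _ _ (\sum_r \sum_c (`|W r c|
    + `|(delta_mx i' j : 'M[R]_(m, n)) r c|
    + `|(delta_mx i j : 'M[R]_(m, n)) r c|))).
  apply: ler_sum => r _; apply: ler_sum => c _.
  rewrite addBmxE; apply: le_trans (ler_normB _ _) _.
  by rewrite lerD2r ler_normD.
under eq_bigr do rewrite !big_split /=.
by rewrite !big_split /= !sum_norm_delta -[k.+1]addn1 natrD; lra.
Qed.

(** Divided by its number of steps, the weight of a closed walk is feasible. *)
Lemma closed_altwalk_le L W0 i k W : dual_optimal L W0 -> altwalk i i k.+1 W ->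
  pairing W L <= k.+1%:R * pairing W0 L.
Proof.
move=> [_ Wmax] walkW; have k0 : 0 < k.+1%:R :> R by rewrite ltr0n.
rewrite -ler_pdivrMl // -pairingZl; apply: Wmax; exists (k.+1%:R^-1 *: W) => //.
apply: dual_feasibleZ.
- by rewrite invr_ge0 ltW.
- by rewrite ler_pdivrMl // mulrC (altwalk_norm walkW).
- by move=> r; rewrite (altwalk_row r walkW) subrr.
- by move=> c; exact: altwalk_col walkW.
Qed.

(** The potential of [i] is the supremum of the gains of all walks from [i0] to
[i].  Appending a step to such a walk gives the inequality, and appending a step
back to [i0] closes it, which bounds its gain. *)
Lemma potential_exists L W0 (j0 : 'I_n) (i0 : 'I_m) : dual_optimal L W0 ->
  exists p : 'I_m -> R, forall i i' j,
    p i + (L i' j - L i j - pairing W0 L) <= p i'.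
Proof.
move=> Wopt; set t := pairing W0 L.
pose gains i :=
  [set g | exists k W, altwalk i0 i k W /\ g = pairing W L - k%:R * t].
have gainsS i i' j g : gains i g -> gains i' (g + (L i' j - L i j - t)).
  move=> [k [W [walkW ->]]].
  exists k.+1, (W + delta_mx i' j - delta_mx i j).
  split; first exact: altwalkS.
  rewrite pairingBl pairingDl !pairing_delta -[k.+1]addn1 natrD; ring.
have gains0 : gains i0 0.
  exists 0%N, 0; split; first exact: altwalk0.
  by rewrite mul0r subr0 pairing0l.
have gains_ub i : has_ubound (gains i).
  (* Minus the gain of the closing step from [i] to [i0] through [j0]. *)
  exists (- (L i0 j0 - L i j0 - t)) => g /(gainsS i i0 j0)[[|k] [W [walkW]]].
    by inversion_clear walkW; rewrite pairing0l; lra.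
  by have := closed_altwalk_le Wopt walkW; rewrite -/t; lra.
exists (fun i => sup (gains i)) => i i' j; rewrite -lerBrDr.
apply: ge_sup; first by exists (0 + (L i j0 - L i0 j0 - t)); exact: gainsS.
move=> g gi; rewrite lerBrDr.
exact: (ub_le_sup (gains_ub i') (gainsS _ _ _ _ gi)).
Qed.

Lemma spread_le M lo hi (i0 : 'I_m) (j0 : 'I_n) :
  (forall i j, lo <= M i j <= hi) -> spread M <= hi - lo.
Proof.
move=> Mb; have ne : (entries M !=set0) by exists (M i0 j0); exact: entriesP.
rewrite /spread lerB //.
  by apply: ge_sup => // _ [[i j] _ <-]; case/andP: (Mb i j).
by apply: lb_le_inf => // _ [[i j] _ <-]; case/andP: (Mb i j).
Qed.

(** A residual with entries in [[0, t]] has spread at most [t], and weak duality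
excludes a smaller spread. *)
Lemma strong_duality L W0 (i0 : 'I_m) (j0 : 'I_n) : dual_optimal L W0 ->
  exists a b, spread (residual L a b) = pairing W0 L.
Proof.
move=> Wopt; have [p pP] := potential_exists j0 i0 Wopt.
set t := pairing W0 L in pP *.
(* [b j] has to lie between every [L i j - p i - t] and every
   [L i j - p i]; the least upper bound of the former is taken. *)
pose slack j := range (fun i => L i j - p i - t).
exists (\row_i p i), (\row_j sup (slack j)).
apply/eqP; rewrite eq_le weak_duality ?andbT; last by case: Wopt.
rewrite -[leRHS]subr0; apply: spread_le => // i j.
rewrite !mxE; apply/andP; split.
  rewrite subr_ge0; apply: ge_sup; first by exists (L i0 j - p i0 - t), i0.
  by move=> _ [i' _ <-]; have := pP i i' j; lra.
have : L i j - p i - t <= sup (slack j); last by lra.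
by apply: ub_le_sup; [exact: has_ubound_finite | exists i].
Qed.

Lemma pairing_ge0_opt L W : dual_optimal L W -> 0 <= pairing W L.
Proof.
case=> _; apply; exists 0; first exact: dual_feasible0.
exact: pairing0l.
Qed.

(** Rescaling to total absolute value 2 is a dilation, by a factor at least 1;
it does not decrease the pairing, which is nonnegative at an optimum.  As the
total sum of a feasible weight is 0, its positive and negative parts then have
equal sums, namely 1. *)
Lemma normalize_optimal L W : dual_optimal L W -> W != 0 ->
  exists2 c : R, 0 < c &
    [/\ dual_optimal L (c *: W),
        \sum_i \sum_j pos_part_mx (c *: W) i j = 1
      & \sum_i \sum_j neg_part_mx (c *: W) i j = 1].
Proof.
move=> Wopt W0; have [[rowW colW W2] Wmax] := Wopt.
set N := \sum_i \sum_j `|W i j| in W2.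
have N0 : 0 < N.
  rewrite lt_neqAle sumr_ge0 ?andbT => [|i _]; last exact: sumr_ge0.
  apply: contra W0; rewrite eq_sym psumr_eq0 => [/allP Z|i _]; last first.
    exact: sumr_ge0.
  apply/eqP/matrixP => i j; rewrite mxE; apply/eqP; rewrite -normr_eq0.
  have := Z i (mem_index_enum i); rewrite /= psumr_eq0 // => /allP/(_ j).
  by rewrite mem_index_enum; apply.
have c0 : 0 < 2 / N by rewrite divr_gt0.
have Wf : dual_feasible (2 / N *: W).
  by apply: dual_feasibleZ => //; [exact: ltW | rewrite divfK // gt_eqF].
exists (2 / N) => //; set W' := _ *: W in Wf *.
have diff : \sum_i \sum_j pos_part_mx W' i j -
            \sum_i \sum_j neg_part_mx W' i j = 0.
  rewrite -[RHS](sum_dual_feasible Wf) -sumrB; apply: eq_bigr => i _.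
  rewrite -sumrB; apply: eq_bigr => j _; rewrite !mxE.
  by case: (ltP _ 0); case: (ltP (- _) 0); lra.
have add : \sum_i \sum_j pos_part_mx W' i j +
           \sum_i \sum_j neg_part_mx W' i j = 2.
  transitivity (2 / N * N); last by rewrite divfK // gt_eqF.
  rewrite -big_split mulr_sumr; apply: eq_bigr => i _.
  rewrite -big_split mulr_sumr; apply: eq_bigr => j _ /=; rewrite /W' !mxE.
  rewrite -[X in X * `|_|]gtr0_norm // -normrM.
  by case: (ltP _ 0); case: (ltP (- _) 0); case: ler0P; lra.
split; [split=> // | lra | lra].
move=> x /Wmax /le_trans; apply; rewrite pairingZl ler_peMl ?pairing_ge0_opt //.
by rewrite ler_pdivlMr // mul1r.
Qed.

End Duality.

(** * Generalized eigenvalues of Kronecker pencils *)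

Lemma gen_eigenvalues_diag (R : realType) N (d e : 'rV[R]_N) :
  (forall k, e 0 k != 0) ->
  gen_eigenvalues (diag_mx e) (diag_mx d) = range (fun k => d 0 k / e 0 k).
Proof.
move=> e0; apply/seteqP; split=> lam.
  case=> v v0 /matrixP eqv.
  have /cV0Pn[k vk] := v0.
  exists k => //; have := eqv k 0.
  rewrite !mul_diag_mx !mxE mulrA => /(mulIf vk) ->.
  by rewrite mulfK.
case=> k _ <-; exists (delta_mx k 0).
  by apply/cV0Pn; exists k; rewrite mxE !eqxx oner_neq0.
apply/matrixP => i j; rewrite !mul_diag_mx !mxE.
by case: eqVneq => [->|_]; rewrite ?mulr0 // mulrA divfK.
Qed.

(** The change of variable [v = Q *m w] matches the eigenvectors. *)
Lemma gen_eigenvalues_congr (R : realType) N (Q G H : 'M[R]_N) :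
  orthogonal_mx Q ->
  gen_eigenvalues (Q *m G *m Q^T) (Q *m H *m Q^T) = gen_eigenvalues G H.
Proof.
move=> QTQ; have QQT := mulmx1C QTQ.
apply/seteqP; split=> lam [v v0 eqv].
  exists (Q^T *m v).
    apply: contra v0 => /eqP /(congr1 (mulmx Q)).
    by rewrite mulmxA QQT mul1mx mulmx0 => ->.
  move/(congr1 (mulmx Q^T)): eqv.
  by rewrite -scalemxAr !mulmxA QTQ !mul1mx.
exists (Q *m v).
  apply: contra v0 => /eqP /(congr1 (mulmx Q^T)).
  by rewrite mulmxA QTQ mul1mx mulmx0 => ->.
by rewrite -!mulmxA ![Q^T *m _]mulmxA QTQ !mul1mx eqv -!scalemxAr.
Qed.

Lemma orthogonal_tens (R : realType) m n (U : 'M[R]_m) (V : 'M[R]_n) :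
  orthogonal_mx U -> orthogonal_mx V -> orthogonal_mx (tensmx V U).
Proof.
rewrite /orthogonal_mx => UU VV; rewrite trmx_tens tensmx_mul UU VV.
apply/matrixP => k l.
case: (mxtens_indexP k) => i j; case: (mxtens_indexP l) => i' j'.
by rewrite tensmxE !mxE (can_eq (@mxtens_indexK _ _)) -natrM mulnb.
Qed.

Lemma kron_family_spectral (R : realType) m n (U : 'M[R]_m) (V : 'M[R]_n)
    (a : 'rV[R]_m) (b : 'rV[R]_n) :
  tensmx (V *m diag_mx (map_mx expR b) *m V^T)
         (U *m diag_mx (map_mx expR a) *m U^T)
  = kron_spectral U V (\matrix_(i, j) (expR (a 0 i) * expR (b 0 j))).
Proof.
rewrite -!tensmx_mul /kron_spectral trmx_tens; congr (_ *m _ *m _).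
apply/matrixP => k l.
case: (mxtens_indexP k) => i j; case: (mxtens_indexP l) => i' j'.
rewrite tensmxE !mxE mxtens_indexK (can_eq (@mxtens_indexK _ _)) /=.
rewrite xpair_eqE.
case: (i == i'); case: (j == j');
  by rewrite ?mulr1n ?mulr0n ?mulr0 ?mul0r // mulrC.
Qed.

Lemma gen_eigenvalues_kron (R : realType) m n (U : 'M[R]_m) (V : 'M[R]_n)
    (g h : 'M[R]_(m, n)) :
  orthogonal_mx U -> orthogonal_mx V -> (forall i j, g i j != 0) ->
  gen_eigenvalues (kron_spectral U V g) (kron_spectral U V h) =
  entries (\matrix_(i, j) (h i j / g i j)).
Proof.
move=> oU oV g0; rewrite gen_eigenvalues_congr; last exact: orthogonal_tens.
rewrite gen_eigenvalues_diag => [|k]; last by rewrite mxE.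
apply/seteqP; split=> lam.
  case=> k _ <-; exists ((mxtens_unindex k).2, (mxtens_unindex k).1) => //=.
  by rewrite !mxE.
case=> -[i j] _ <-; exists (mxtens_index (j, i)) => //.
by rewrite !mxE mxtens_indexK.
Qed.

(** The infimum is positive, being at least the exponential of the smallest
logarithm; hence the quotient is positive as well and its logarithm is a
difference. *)
Lemma expR_spread_ln_le (R : realType) m n (A : 'M[R]_(m, n))
    (i0 : 'I_m) (j0 : 'I_n) :
  (forall i j, 0 < A i j) ->
  expR (spread (map_mx (@ln R) A)) <= sup (entries A) / inf (entries A).
Proof.
move=> A0.
have inf_gt0 : 0 < inf (entries A).
  apply: (lt_le_trans (expR_gt0 (inf (entries (map_mx (@ln R) A))))).
  apply: lb_le_inf => [|_ [[i j] _ <-]].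
    by exists (A i0 j0); exact: entriesP.
  rewrite -[leRHS]lnK ?posrE // ler_expR.
  by have := inf_entries_le (map_mx (@ln R) A) i j; rewrite mxE.
have sup_gt0 : 0 < sup (entries A).
  exact: lt_le_trans (A0 i0 j0) (le_sup_entries _ _ _).
rewrite -[leRHS]lnK ?posrE ?divr_gt0 // ler_expR ln_div ?posrE //.
apply: spread_le => // i j; rewrite mxE.
by rewrite !ler_ln ?posrE // inf_entries_le le_sup_entries.
Qed.

(** * The dual representation and the certificate *)

Theorem theorem5p20 (R : realType) (m n : nat) (K : R)
    (U : 'M[R]_m) (V : 'M[R]_n) (h : 'M[R]_(m, n))
    (H : 'M[R]_(n * m)) (L : 'M[R]_(m, n)) :
  (2 <= m)%N -> (2 <= n)%N -> 1 <= K ->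
  orthogonal_mx U -> orthogonal_mx V ->
  (forall i j, 0 < h i j) ->
  H = kron_spectral U V h ->
  L = log_mx h ->
  [/\ is_minimum (primal_values L) (tau_star L),
      is_maximum (dual_values L) (tau_star L),
      (forall W : 'M[R]_(m, n), dual_optimal L W -> W != 0 ->
         exists2 c : R, 0 < c &
           [/\ dual_optimal L (c *: W),
               \sum_i \sum_j pos_part_mx (c *: W) i j = 1
             & \sum_i \sum_j neg_part_mx (c *: W) i j = 1])
    & (forall W : 'M[R]_(m, n), dual_feasible W -> ln K < pairing W L ->
         ~ exists2 G : 'M[R]_(n * m), kron_family U V G & gen_cond G H <= K)].
Proof.
move=> m2 n2 K1 oU oV h0 -> ->.
pose i0 := Ordinal (ltnW m2); pose j0 := Ordinal (ltnW n2).
have [W0 W0opt] := dual_optimal_exists (log_mx h).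
have [W0f W0max] := W0opt.
have [a [b ab]] := strong_duality i0 j0 W0opt.
have primal_min : is_minimum (primal_values (log_mx h)) (pairing W0 (log_mx h)).
  split; first by exists a, b; rewrite -ab.
  by move=> _ [a' [b' ->]]; exact: weak_duality.
have tauE : tau_star (log_mx h) = pairing W0 (log_mx h).
  case: primal_min => P_in P_lb; apply/eqP; rewrite eq_le /tau_star.
  rewrite lb_le_inf ?andbT //; last by exists (pairing W0 (log_mx h)).
  by apply: ge_inf => //; exists (pairing W0 (log_mx h)).
rewrite tauE; split=> //.
- by split; first exact: imageP.
- by move=> W; exact: normalize_optimal.
move=> W Wf KW [G [a' [b' ->]] condK]; move: KW; apply/negP; rewrite -leNgt.
apply: le_trans (weak_duality _ a' b' Wf) _.
set g : 'M[R]_(m, n) := \matrix_(i, j) (expR (a' 0 i) * expR (b' 0 j)).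
have g_gt0 i j : 0 < g i j by rewrite mxE mulr_gt0 ?expR_gt0.
pose A : 'M[R]_(m, n) := \matrix_(i, j) (h i j / g i j).
have A_gt0 i j : 0 < A i j by rewrite mxE divr_gt0.
have -> : residual (log_mx h) a' b' = map_mx (@ln R) A.
  apply/matrixP => i j; rewrite !mxE ln_div ?posrE ?mulr_gt0 ?expR_gt0 //.
  by rewrite lnM ?posrE ?expR_gt0 // !expRK opprD addrA.
rewrite -ler_expR lnK ?posrE ?(lt_le_trans ltr01) //.
apply: le_trans (expR_spread_ln_le i0 j0 A_gt0) _.
move: condK; rewrite kron_family_spectral -/g /gen_cond.
rewrite gen_eigenvalues_kron // => i j.
by rewrite gt_eqF.
Qed.
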